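(* Let $\mathbb{M}\subset\mathbb{R}^d$ be a compact smooth $p$-dimensional submanifold of $\mathbb{R}^d$ without boundary. Assume that the quantity $\bigl|2\|B_x\|^2-\|H_x\|^2\bigr|$ is uniformly bounded with respect to $x\in\mathbb{M}$. Then, as $\varepsilon\to0$, $$\frac{\ln P(\mathbb{M},\varepsilon)}{\ln\left(\left(\frac1\varepsilon\right)^p\frac{p\,\mathrm{Vol}(\mathbb{M})}{\sigma_{p-1}}\right)+o(1)}\longrightarrow 1.$$
   Context: $P(\mathbb{M},\varepsilon)=\sup\{N\in\mathbb{N}:\exists\,x_1,\dots,x_N\in\mathbb{M},\ \|x_i-x_j\|>2\varepsilon\ \forall i\ne j\}$ is the maximal $\varepsilon$-packing number, with $\|\cdot\|$ the Euclidean norm. $\mathrm{Vol}(\mathbb{M})$ is the $p$-dimensional (Riemannian) volume of $\mathbb{M}$. $\sigma_{p-1}=2\pi^{p/2}/\Gamma(p/2)$ is the surface measure of the unit sphere in $\mathbb{R}^p$. $B_x$ is the second fundamental form of $\mathbb{M}$ at $x$, $H_x=\operatorname{trace}(B_x)$ is the mean curvature normal vector, $\|H_x\|$ its Euclidean norm, and $\|B_x\|^2=\sum_{i,j=1}^p\|B_x(e_i,e_j)\|^2$ for any orthonormal basis $(e_i)_{1\le i\le p}$ of $T_x\mathbb{M}$. The term $o(1)$ denotes some function of $\varepsilon$ tending to $0$ as $\varepsilon\to0$. *)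

(* Defs.v *)
From HB Require Import structures.
From mathcomp Require Import all_boot all_order all_algebra.
From mathcomp Require Import all_classical all_reals all_analysis.

Set Implicit Arguments.
Unset Strict Implicit.
Unset Printing Implicit Defensive.

Import Order.TTheory GRing.Theory Num.Theory.
Import numFieldNormedType.Exports.

Local Open Scope classical_set_scope.
Local Open Scope ring_scope.

(* The library norm `|x| on row vectors is the max norm: it induces the usual
   topology on R^d, but lengths have to be measured with [enorm]. *)
Definition dotrV (R : realType) (d : nat) (x y : 'rV[R]_d) : R :=
  \sum_(i < d) x ord0 i * y ord0 i.

Definition enorm (R : realType) (d : nat) (x : 'rV[R]_d) : R :=
  Num.sqrt (dotrV x x).

(* [sup] is the supremum in R; for eps > 0 and M nonempty and bounded it is
   the supremum of a nonempty bounded set of integers. *)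
Definition packing_number (R : realType) (d : nat) (M : set 'rV[R]_d)
    (eps : R) : R :=
  sup [set N%:R | N in [set N : nat | exists x : 'I_N -> 'rV[R]_d,
    (forall i, M (x i)) /\
    (forall i j, i != j -> 2 * eps < enorm (x i - x j))]].

(* C^oo on an open set U: every iterated directional derivative is
   differentiable (hence continuous) at every point of U. *)
Definition smooth_on (R : realType) (V W : normedModType R)
    (U : set V) (f : V -> W) : Prop :=
  forall (vs : seq V) (u : V), U u ->
    differentiable (foldr (fun v (g : V -> W) => 'D_v g) f vs) u.

(* phi restricted to U is a smooth immersion and a homeomorphism onto a
   relatively open subset of M; the last clause says that phi : U -> M is an
   open map for the topology induced on M (for W = U it gives phi(U) in M).
   The rows of 'J phi u are the partial derivatives of phi at u. *)
Record local_parametrization (R : realType) (d p : nat) (M : set 'rV[R]_d)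
    (U : set 'rV[R]_p) (phi : 'rV[R]_p -> 'rV[R]_d) : Prop := {
  lp_open : open U ;
  lp_smooth : smooth_on U phi ;
  lp_immersion : forall u, U u -> row_free ('J phi u) ;
  lp_injective : set_inj U phi ;
  lp_open_map : forall W : set 'rV[R]_p, open W -> W `<=` U ->
    exists2 V : set 'rV[R]_d, open V & phi @` W = M `&` V }.

Definition smooth_submanifold (R : realType) (d p : nat)
    (M : set 'rV[R]_d) : Prop :=
  forall x, M x -> exists (U : set 'rV[R]_p) (phi : 'rV[R]_p -> 'rV[R]_d),
    local_parametrization M U phi /\ (phi @` U) x.

Definition tangent_space (R : realType) (d p : nat) (M : set 'rV[R]_d)
    (x : 'rV[R]_d) : set 'rV[R]_d :=
  [set v | exists (U : set 'rV[R]_p) (phi : 'rV[R]_p -> 'rV[R]_d)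
             (u a : 'rV[R]_p),
    [/\ local_parametrization M U phi, U u, phi u = x & v = 'd phi u a]].

Definition normal_space (R : realType) (d p : nat) (M : set 'rV[R]_d)
    (x : 'rV[R]_d) : set 'rV[R]_d :=
  [set n | forall v, tangent_space p M x v -> dotrV n v = 0].

(* B_x(v, w) is the normal component of the derivative along v of any smooth
   vector field Y defined near x, tangent to M along M, with Y(x) = w.  For v
   and w in T_x M it does not depend on Y; other arguments are irrelevant. *)
Definition second_fundamental_form (R : realType) (d p : nat)
    (M : set 'rV[R]_d) (x v w : 'rV[R]_d) : 'rV[R]_d :=
  get [set b | exists (V : set 'rV[R]_d) (Y : 'rV[R]_d -> 'rV[R]_d),
    [/\ open V /\ V x,
        smooth_on V Y,
        forall y, M y -> V y -> tangent_space p M y (Y y),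
        Y x = w &
        normal_space p M x b /\ tangent_space p M x ('D_v Y x - b)]].

(* The rows of E form an orthonormal basis of T_x M. *)
Definition orthonormal_tangent_basis (R : realType) (d p : nat)
    (M : set 'rV[R]_d) (x : 'rV[R]_d) (E : 'M[R]_(p, d)) : Prop :=
  E *m E^T = 1%:M /\
  tangent_space p M x = [set a *m E | a in [set: 'rV[R]_p]].

(* An arbitrary choice: the two quantities below do not depend on it. *)
Definition tangent_basis (R : realType) (d p : nat) (M : set 'rV[R]_d)
    (x : 'rV[R]_d) : 'M[R]_(p, d) :=
  get [set E | orthonormal_tangent_basis M x E].

Definition sff_sqnorm (R : realType) (d p : nat) (M : set 'rV[R]_d)
    (x : 'rV[R]_d) : R :=
  let E := tangent_basis p M x in
  \sum_(i < p) \sum_(j < p)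
    enorm (second_fundamental_form p M x (row i E) (row j E)) ^+ 2.

(* The trace itself, not divided by p. *)
Definition mean_curvature_vector (R : realType) (d p : nat)
    (M : set 'rV[R]_d) (x : 'rV[R]_d) : 'rV[R]_d :=
  let E := tangent_basis p M x in
  \sum_(i < p) second_fundamental_form p M x (row i E) (row i E).

(* Lebesgue integral over R^n of a nonnegative Borel function, written as an
   iterated integral (Tonelli). *)
Fixpoint integral_rV (R : realType) (n : nat) :
    ('rV[R]_n -> \bar R) -> \bar R :=
  if n is m.+1 then fun f : 'rV[R]_(1 + m) -> \bar R =>
    (\int[lebesgue_measure]_(t in [set: R])
       integral_rV (fun v : 'rV[R]_m => f (row_mx t%:M v)))%E
  else fun f => f 0.

Definition gram (R : realType) (d p : nat) (phi : 'rV[R]_p -> 'rV[R]_d)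
    (u : 'rV[R]_p) : 'M[R]_p :=
  'J phi u *m ('J phi u)^T.

(* v = sum_i int_(U_i) rho_i(phi_i(u)) sqrt(det g_i(u)) du, where the phi_i
   are local parametrizations of M, g_i is the matrix of the Riemannian metric
   in the chart phi_i, and (rho_i) is a partition of unity on M subordinate to
   the cover (phi_i(U_i)). *)
Definition is_riemannian_volume (R : realType) (d p : nat)
    (M : set 'rV[R]_d) (v : R) : Prop :=
  exists (k : nat) (U : 'I_k -> set 'rV[R]_p)
    (phi : 'I_k -> 'rV[R]_p -> 'rV[R]_d) (rho : 'I_k -> 'rV[R]_d -> R),
  [/\ forall i, local_parametrization M (U i) (phi i),
      forall i, continuous (rho i) /\ (forall x, 0 <= rho i x),
      forall i, exists2 K, compact K /\ K `<=` phi i @` U i &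
        forall x, M x -> ~ K x -> rho i x = 0,
      forall x, M x -> \sum_(i < k) rho i x = 1 &
      v%:E = (\sum_(i < k) integral_rV (fun u =>
        (\1_(U i) u * rho i (phi i u) * Num.sqrt (\det (gram (phi i) u)))%:E))%E].

(* Vol(M), for compact M: the volume does not depend on the charts or on the
   partition of unity. *)
Definition riemannian_volume (R : realType) (d p : nat)
    (M : set 'rV[R]_d) : R :=
  get [set v | is_riemannian_volume p M v].

Definition Gamma (R : realType) (s : R) : R :=
  \int[lebesgue_measure]_(t in `]0, +oo[%classic) (t `^ (s - 1) * expR (- t)).

(* sigma_(p-1): indexed by the dimension p of the ambient space. *)
Definition sphere_area (R : realType) (p : nat) : R :=
  2 * pi `^ (p%:R / 2) / Gamma (p%:R / 2).

(* Main.v *)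
Require Import Defs.
From HB Require Import structures.
From mathcomp Require Import all_boot all_order all_algebra.
From mathcomp Require Import all_classical all_reals all_analysis.
From mathcomp Require Import measurable_realfun ring lra.

Import Order.TTheory GRing.Theory Num.Theory.
Import numFieldNormedType.Exports.

Set Implicit Arguments.
Unset Strict Implicit.
Unset Printing Implicit Defensive.

Local Open Scope classical_set_scope.
Local Open Scope ring_scope.

(** The logarithm turns bounded factors into bounded summands, and the
    denominator is p ln(1/eps) + O(1).  So the limit only requires the packing
    number to have the exact order eps^-p, i.e. positive constants C1, C2 with
    C1 eps^-p <= P(M, eps) <= C2 eps^-p for small eps ([ln_ratio_cvg]), and
    the constant p Vol(M) / sigma_(p-1) to be positive; the error term can
    then be taken to be 0.

    Order of the packing number.  A parametrization phi is locally Lipschitz,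
    by the mean value theorem on segments.  By compactness M is covered by
    finitely many images of balls under maps that are L-Lipschitz; the
    preimages of 2 eps-separated points are separated at the scale eps / L, so
    the pigeonhole principle on a grid of R^p gives the upper bound
    ([submanifold_packing_ub]).  For the lower bound, one chart is enough: an
    immersion is locally bounded below by a multiple of the distance
    ([immersion_expanding]), so it maps a grid of mesh proportional to eps to a
    separated family of M ([submanifold_packing_lb]).

    Positivity of the constant.  The volume is chosen among the numbers that
    are computed from some partition of unity, so two facts are needed.  Such
    a number exists: a partition of unity made of tent functions, subordinate
    to charts where the volume density is bounded, gives finite integrals
    ([riemannian_volume_exists]).  Every such number is positive: one of the
    integrands is bounded below on a box, because the Gram determinant of an
    immersion is positive ([det_gram_gt0], [riemannian_volume_witness_gt0]).
    In both cases the integrand is only compared with multiples of indicators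
    of boxes.  Finally sigma_(p-1) is positive because the integral defining
    Gamma converges ([Gamma_gt0]). *)

(** * The max norm on row vectors *)

Lemma ler_coord_norm (R : realType) (m n : nat) (A : 'M[R]_(m, n)) i j :
  `|A i j| <= `|A|.
Proof.
rewrite [leRHS]/Num.norm /= mx_normrE.
exact: (le_bigmax _ (fun ij : 'I_m * 'I_n => `|A ij.1 ij.2|) (i, j)).
Qed.

Lemma norm_rV_le (R : realType) (n : nat) (x : 'rV[R]_n) (c : R) :
  0 <= c -> (forall j, `|x ord0 j| <= c) -> `|x| <= c.
Proof.
move=> c0 xc; rewrite [leLHS]/Num.norm /= mx_normrE; apply/bigmax_leP; split => //.
by move=> [i j] _ /=; rewrite (ord1 i).
Qed.

Lemma norm_mulmx_le (R : realType) (m n : nat) (x : 'rV[R]_m)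
    (A : 'M[R]_(m, n)) (c : R) :
  0 <= c -> (forall i j, `|A i j| <= c) -> `|x *m A| <= m%:R * c * `|x|.
Proof.
move=> c0 Ac; apply: norm_rV_le => [|j]; first by rewrite !mulr_ge0.
rewrite mxE (le_trans (ler_norm_sum _ _ _))//.
rewrite -mulrA mulr_natl -[m in _ *+ m]card_ord -sumr_const ler_sum// => i _.
by rewrite normrM mulrC ler_pM// ler_coord_norm.
Qed.

(** Convexity of balls, needed to apply the mean value theorem along the
    segment from v to u. *)
Lemma ball_segment (R : realType) (n : nat) (u0 u v : 'rV[R]_n) (r t : R) :
  0 <= t <= 1 -> ball u0 r u -> ball u0 r v -> ball u0 r (v + t *: (u - v)).
Proof.
rewrite !mx_norm_ball /ball_ /= => /andP[t0 t1] ur vr.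
have -> : u0 - (v + t *: (u - v)) = (1 - t) *: (u0 - v) + t *: (u0 - u).
  by apply/rowP => j; rewrite !mxE; ring.
rewrite (le_lt_trans (ler_normD _ _))// !normrZ !ger0_norm ?subr_ge0//.
have [->|t0'] := eqVneq t 0; first by rewrite mul0r addr0 subr0 mul1r.
have : t * `|u0 - u| < t * r by rewrite ltr_pM2l// lt0r t0'.
have : (1 - t) * `|u0 - v| <= (1 - t) * r by rewrite ler_wpM2l ?subr_ge0// ltW.
by lra.
Qed.

(** * Local distortion of differentiable maps *)

(** The mean value theorem has no vector-valued form, but it suffices to apply
    it to each coordinate of f along the segment, since the norm is the max
    norm; the point c then depends on the coordinate, which the uniform bound
    on the Jacobian absorbs. *)
Lemma lipschitz_of_jacobian_bound (R : realType) (p q : nat)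
    (f : 'rV[R]_p -> 'rV[R]_q) (u0 : 'rV[R]_p) (r L : R) :
  0 <= L ->
  (forall w, ball u0 r w -> differentiable f w) ->
  (forall w, ball u0 r w -> forall i j, `|'J f w i j| <= L) ->
  forall u v, ball u0 r u -> ball u0 r v -> `|f u - f v| <= p%:R * L * `|u - v|.
Proof.
move=> L0 fd fL u v ur vr.
apply: norm_rV_le => [|j]; first by rewrite !mulr_ge0.
pose l (t : R) := v + t *: (u - v).
pose g (t : R) := f (l t) ord0 j.
have lr t : 0 <= t <= 1 -> ball u0 r (l t) by move=> ?; exact: ball_segment.
have gd (t : R) : 0 <= t <= 1 ->
    is_derive t 1 g (((u - v) *m 'J f (l t)) ord0 j).
  move=> /lr lt.
  have ld : is_diff t l (0 + *:%R ^~ (u - v)).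
    by apply: is_diffD.
  have fld : differentiable (f \o l) t.
    by apply: differentiable_comp; [apply: ex_diff|apply: fd].
  have gE : g = (fun s => (f \o l) s ord0 j) by [].
  have fldd : derivable (f \o l) t 1 by exact: diff_derivable.
  have gd1 : derivable g t 1 by exact: (derivable_mxP _ _ _).1.
  apply: DeriveDef => //.
  have <- : 'D_1 (f \o l) t ord0 j = 'D_1 g t by rewrite derive_mx// mxE.
  rewrite deriveE// diff_comp//=; last exact: fd.
  by rewrite diff_val /= add0r scale1r /jacobian mul_rV_lin1.
have gc : {within `[0, 1], continuous g}.
  apply: derivable_within_continuous => t; rewrite in_itv/= => t01.
  exact: (@ex_derive _ _ _ _ _ _ _ (gd t t01)).
have gd' (t : R) : t \in `]0, 1[%R -> is_derive t 1 g (((u - v) *m 'J f (l t)) ord0 j).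
  by rewrite in_itv/= => /andP[t0 t1]; apply: gd; rewrite !ltW.
have [c c01] := MVT ltr01 gd' gc.
rewrite subr0 mulr1 /g /l scale1r scale0r addr0 [v + _]addrC subrK => fE.
rewrite -[leLHS]/(`|(f u - f v) ord0 j|) mxE [X in _ + X]mxE fE.
apply: le_trans (ler_coord_norm _ _ _) _.
apply: norm_mulmx_le => // i k; apply: fL; apply: lr.
by move: c01; rewrite in_itv/= => /andP[? ?]; rewrite !ltW.
Qed.

Lemma lipschitz_near (R : realType) (p q : nat)
    (f : 'rV[R]_p -> 'rV[R]_q) (u0 : 'rV[R]_p) (L : R) :
  0 <= L ->
  (\forall w \near u0, differentiable f w) ->
  (forall i j, {for u0, continuous (fun w => 'J f w i j)}) ->
  (forall i j, `|'J f u0 i j| < L) ->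
  \forall r \near 0^'+, forall u v, ball u0 r u -> ball u0 r v ->
    `|f u - f v| <= p%:R * L * `|u - v|.
Proof.
move=> L0 fd Jc JL.
have : \forall w \near u0, differentiable f w /\ forall i j, `|'J f w i j| <= L.
  near=> w; split; first by near: w.
  near: w; apply: filter_forall => i; apply: filter_forall => j.
  by apply: cvgr_norm_le (JL i j); exact: Jc.
move=> /nbhs_ballP[e /= e0 fe]; near=> r => u v ur vr.
have re w : ball u0 r w -> ball u0 e w.
  by apply: le_ball; near: r; exact: nbhs_right_le.
have rd w : ball u0 r w -> differentiable f w by move=> /re /fe[].
have rJ w : ball u0 r w -> forall i j, `|'J f w i j| <= L by move=> /re /fe[].
exact: (lipschitz_of_jacobian_bound L0 rd rJ).
Unshelve. all: by end_near. Qed.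

Lemma jacobianE (R : realType) (p q : nat) (f : 'rV[R]_p -> 'rV[R]_q) w i j :
  'J f w i j = 'd f w (delta_mx ord0 i) ord0 j.
Proof. by rewrite /jacobian /lin1_mx mxE. Qed.

(** The rows of the Jacobian are the directional derivatives along the basis
    vectors, which are differentiable, hence continuous. *)
Lemma smooth_jacobian_continuous (R : realType) (p q : nat)
    (U : set 'rV[R]_p) (f : 'rV[R]_p -> 'rV[R]_q) u i j :
  open U -> smooth_on U f -> U u -> {for u, continuous (fun w => 'J f w i j)}.
Proof.
move=> oU sf Uu; rewrite /prop_for /continuous_at.
have dfc : {for u, continuous ('D_(delta_mx ord0 i) f)}.
  exact/differentiable_continuous/(sf [:: _] u Uu).
have JE : \forall w \near u, 'D_(delta_mx ord0 i) f w ord0 j = 'J f w i j.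
  near=> w; rewrite jacobianE deriveE//.
  by apply: (sf [::]); near: w; exact: open_nbhs_nbhs.
apply: cvg_trans (near_eq_cvg JE) _.
rewrite -(nbhs_singleton JE).
exact: (cvg_comp _ _ dfc (@coord_continuous _ _ _ _ _ _)).
Unshelve. all: by end_near. Qed.

Lemma mulmxr_continuous (R : realType) (p q : nat) (B : 'M[R]_(p, q)) :
  continuous (mulmxr B : 'rV[R]_p -> 'rV[R]_q).
Proof.
apply/bounded_linear_continuous/linear_boundedP.
near=> k => x.
have Bc i j : `|B i j| <= `|B| by exact: ler_coord_norm.
apply: le_trans (norm_mulmx_le x (normr_ge0 B) Bc) _.
by apply: ler_wpM2r => //; near: k; exact: nbhs_pinfty_ge.
Unshelve. all: by end_near. Qed.

(** Let B be a right inverse of the Jacobian J at u0.  The map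
    h = f B - id has zero Jacobian at u0, so near u0 it is Lipschitz with
    constant 1/2, and u - v = (f u - f v) B - (h u - h v) gives
    |u - v| <= |(f u - f v) B| + |u - v| / 2.  This is the quantitative half of
    the inverse function theorem. *)
Lemma immersion_expanding (R : realType) (p q : nat)
    (f : 'rV[R]_p -> 'rV[R]_q) (u0 : 'rV[R]_p) :
  (\forall w \near u0, differentiable f w) ->
  (forall i j, {for u0, continuous (fun w => 'J f w i j)}) ->
  row_free ('J f u0) ->
  exists2 c, 0 < c & \forall r \near 0^'+,
    forall u v, ball u0 r u -> ball u0 r v -> c * `|u - v| <= `|f u - f v|.
Proof.
move=> fd Jc /row_freeP[B JB].
pose h (w : 'rV[R]_p) : 'rV[R]_p := f w *m B - w.
have dB (y : 'rV[R]_q) : is_diff y (mulmxr B : 'rV[R]_q -> 'rV[R]_p) (mulmxr B).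
  apply: DiffDef; last by rewrite diff_lin//; exact: mulmxr_continuous.
  by apply: linear_differentiable; exact: mulmxr_continuous.
have hd w : differentiable f w -> is_diff w h (mulmxr B \o 'd f w - id).
  move=> fw; have dfw : is_diff w f ('d f w) by exact: DiffDef.
  exact: is_diffB (is_diff_comp dfw (dB _)) (is_diff_id w).
have hJ w : differentiable f w -> 'J h w = 'J f w *m B - 1%:M.
  move=> /hd hw; apply/row_matrixP => i; rewrite !rowE /jacobian mul_rV_lin1.
  rewrite diff_val mulmxBr mulmx1 mulmxA.
  by rewrite [X in X *m B - _](_ : _ = 'd f w (delta_mx ord0 i))// mul_rV_lin1.
have hJc i j : {for u0, continuous (fun w => 'J h w i j)}.
  rewrite /prop_for /continuous_at.
  have JE : \forall w \near u0,
      \sum_k 'J f w i k * B k j - (1%:M : 'M[R]_p) i j = 'J h w i j.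
    near=> w; rewrite hJ; first by rewrite !mxE.
    by near: w.
  apply: cvg_trans (near_eq_cvg JE) _; rewrite -(nbhs_singleton JE).
  apply: cvgB; last exact: cvg_cst.
  apply: cvg_big => [|k _]; first exact: add_continuous.
  by apply: cvgM; [exact: Jc|exact: cvg_cst].
(* The Lipschitz constant of h given by the mean value theorem is p L. *)
pose L : R := (2 * p.+1%:R)^-1.
have L0 : 0 < L by rewrite invr_gt0 mulr_gt0.
have hnd : \forall w \near u0, differentiable h w.
  by apply: filterS fd => w /hd hw; exact: ex_diff.
have hJL i j : `|'J h u0 i j| < L.
  rewrite hJ; last exact: nbhs_singleton fd.
  by rewrite JB subrr mxE normr0.
have hlip := lipschitz_near (ltW L0) hnd hJc hJL.
pose K : R := q%:R * `|B|.
have K0 : 0 <= K by rewrite mulr_ge0.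
exists (2 * (K + 1))^-1; first by rewrite invr_gt0 mulr_gt0// ltr_wpDl.
apply: filterS hlip => r rlip u v ur vr.
have huv : `|h u - h v| <= 2^-1 * `|u - v|.
  apply: le_trans (rlip u v ur vr) _; apply: ler_wpM2r => //.
  rewrite /L invfM mulrCA ler_piMr// ler_pdivrMr// mul1r ler_nat//.
have Bc i j : `|B i j| <= `|B| by exact: ler_coord_norm.
have fB := norm_mulmx_le (f u - f v) (normr_ge0 B) Bc.
have uvE : u - v = (f u - f v) *m B - (h u - h v).
  by rewrite /h mulmxBl; apply/rowP => j; rewrite !mxE; ring.
have uv : `|u - v| <= K * `|f u - f v| + 2^-1 * `|u - v|.
  rewrite {1}uvE; apply: le_trans (ler_normB _ _) _; exact: lerD.
rewrite mulrC ler_pdivrMr ?mulr_gt0 ?ltr_wpDl//.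
have := normr_ge0 (f u - f v); nra.
Unshelve. all: by end_near. Qed.

(** * Counting separated families *)

(** The form in which compactness is used: a local property, stated with some
    radius at each point, holds on finitely many balls that cover M. *)
Lemma compact_finite_ball_cover (R : realType) (n : nat) (M : set 'rV[R]_n)
    (P : 'rV[R]_n -> R -> Prop) :
  compact M -> (forall x, M x -> exists2 s, 0 < s & P x s) ->
  exists (k : nat) (c : 'I_k -> 'rV[R]_n) (s : 'I_k -> R),
    (forall i, [/\ M (c i), 0 < s i & P (c i) (s i)]) /\
    (forall y, M y -> exists i, ball (c i) (s i) y).
Proof.
rewrite compact_cover => cM MP.
have /choice[s sP] x : exists t : R, M x -> 0 < t /\ P x t.
  have [/MP[t t0 Pt]|nMx] := pselect (M x); first by exists t.
  by exists 0 => /nMx.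
have so x : M x -> open (ball x (s x)) by move=> _; exact: ball_open.
have sM : M `<=` cover M (fun x => ball x (s x)).
  by move=> x Mx; exists x => //; apply: ballxx; exact: (sP x Mx).1.
have [D DM Mcov] := cM _ _ _ so sM.
pose t := in_tuple (finmap.enum_fset D).
exists (size (finmap.enum_fset D)), (tnth t), (fun i => s (tnth t i)); split => [i|y My].
  have Mi : M (tnth t i) by apply/set_mem/DM; exact: mem_tnth.
  by have [? ?] := sP _ Mi.
have [x /= xD yx] := Mcov y My.
have /tnthP[i xi] : x \in t by [].
by exists i; rewrite -xi.
Qed.

Lemma enorm_ge_norm (R : realType) (n : nat) (x : 'rV[R]_n) : `|x| <= enorm x.
Proof.
apply: norm_rV_le => [|j]; first exact: sqrtr_ge0.
rewrite -sqrtr_sqr ler_sqrt /dotrV; last by apply: sumr_ge0 => i _; rewrite -expr2 sqr_ge0.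
by rewrite (bigD1 j)//= -expr2 lerDl sumr_ge0// => i _; rewrite -expr2 sqr_ge0.
Qed.

Lemma enorm_le_norm (R : realType) (n : nat) (x : 'rV[R]_n) :
  enorm x <= n%:R * `|x|.
Proof.
rewrite -(@ler_pXn2r _ 2)// ?nnegrE ?sqrtr_ge0 ?mulr_ge0//.
rewrite sqr_sqrtr; last by apply: sumr_ge0 => i _; rewrite -expr2 sqr_ge0.
apply: (@le_trans _ _ (\sum_(i < n) `|x| ^+ 2)).
  apply: ler_sum => i _; rewrite -expr2 -real_normK ?num_real//.
  by rewrite ler_pXn2r ?nnegrE//; exact: ler_coord_norm.
rewrite sumr_const card_ord exprMn -[leLHS]mulr_natl ler_wpM2r ?exprn_ge0//.
by rewrite -natrX ler_nat; case: n {x} => // n; rewrite leq_pmulr.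
Qed.

(** The integers whose supremum is [packing_number]. *)
Definition has_packing (R : realType) (d : nat) (M : set 'rV[R]_d) (eps : R) (N : nat) :=
  exists x : 'I_N -> 'rV[R]_d, (forall i, M (x i)) /\
    (forall i j, i != j -> 2 * eps < enorm (x i - x j)).

Lemma truncn_eq_dist (R : realType) (x y : R) :
  0 <= x -> 0 <= y -> Num.truncn x = Num.truncn y -> `|x - y| < 1.
Proof.
move=> x0 y0 xy; rewrite ltr_norml.
have /andP[] := truncn_itv x0; have /andP[] := truncn_itv y0.
by rewrite xy -natr1 => *; apply/andP; split; lra.
Qed.

(** The part of M in V is the image of a subset A of a ball of radius r of R^p
    under an L-Lipschitz map.  The set A is separate from the ball so that
    patches with distinct radii can be compared with a common one. *)
Definition lipschitz_patch (R : realType) (d p : nat) (M V : set 'rV[R]_d) (r L : R) :=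
  exists (phi : 'rV[R]_p -> 'rV[R]_d) (u0 : 'rV[R]_p) (A : set 'rV[R]_p),
    [/\ A `<=` ball u0 r,
        forall y, M y -> V y -> exists2 u, A u & phi u = y &
        forall u v, A u -> A v -> `|phi u - phi v| <= L * `|u - v|].

Lemma lipschitz_patchW (R : realType) (d p : nat) (M V : set 'rV[R]_d)
    (r r' L L' : R) :
  r <= r' -> L <= L' ->
  lipschitz_patch p M V r L -> lipschitz_patch p M V r' L'.
Proof.
move=> rr' LL' [phi [u0 [A [Ar AV AL]]]]; exists phi, u0, A; split => //.
- by move=> u /Ar; exact: le_ball.
- by move=> u v Au Av; apply: le_trans (AL u v Au Av) _; rewrite ler_wpM2r.
Qed.

(** Send each point to the pair formed by a patch that contains it and the grid
    cell of its preimage.  With cells of side delta = 2 eps / (d.+1 L), two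
    points with the same image are at Euclidean distance at most 2 eps, so this
    map is injective on a separated family. *)
Lemma has_packing_le (R : realType) (d p k : nat) (M : set 'rV[R]_d)
    (V : 'I_k -> set 'rV[R]_d) (r L : R) :
  0 < r -> 0 < L -> (forall y, M y -> exists i, V i y) ->
  (forall i, lipschitz_patch p M (V i) r L) ->
  forall eps N, 0 < eps <= 1 -> has_packing M eps N ->
    N%:R <= k%:R * (r * (d.+1%:R * L) + 1) ^+ p * eps^-1 ^+ p.
Proof.
move=> r0 L0 Mcov patch eps N /andP[e0 e1] [x [Mx xsep]].
have /choice[a aP] i : exists a, V a (x i) by apply: Mcov.
have /choice[phi /choice[c /choice[A phiP]]] := patch.
have /choice[u uP] i : exists u, A (a i) u /\ phi (a i) u = x i.
  by have [_ /(_ _ (Mx i) (aP i))[v ? ?] _] := phiP (a i); exists v.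
have ucr i : ball (c (a i)) r (u i).
  by have [+ _ _] := phiP (a i); apply; have [] := uP i.
pose D : R := d.+1%:R * L.
have D0 : 0 < D by rewrite mulr_gt0.
pose delta := 2 * eps / D.
have delta0 : 0 < delta by rewrite divr_gt0// mulr_gt0.
(* Coordinates in the grid, shifted by r to be nonnegative. *)
pose z i (j : 'I_p) := (u i ord0 j - c (a i) ord0 j + r) / delta.
have zP i j : 0 <= z i j <= 2 * r / delta.
  have ur := ucr i.
  have : `|u i ord0 j - c (a i) ord0 j| < r.
    move: ur; rewrite mx_norm_ball /ball_ /= distrC; apply: le_lt_trans.
    by have := ler_coord_norm (u i - c (a i)) ord0 j; rewrite !mxE.
  rewrite ltr_norml => /andP[? ?].
  by rewrite /z divr_ge0 ?ler_pM2r ?invr_gt0//=; lra.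
pose m := Num.truncn (2 * r / delta).
have m0 : 0 <= 2 * r / delta by apply: divr_ge0; [rewrite mulr_ge0 ?ltW|exact: ltW].
pose cell i : 'I_k * {ffun 'I_p -> 'I_m.+1} :=
  (a i, [ffun j => inord (Num.truncn (z i j))]).
have cell_inj : injective cell.
  move=> i i' [aE /ffunP cE]; apply/eqP/negPn/negP => /xsep.
  apply/negP; rewrite -leNgt.
  have zz j : `|z i j - z i' j| < 1.
    have /andP[zi0 zi1] := zP i j; have /andP[zi'0 zi'1] := zP i' j.
    apply: truncn_eq_dist => //.
    have := cE j; rewrite !ffunE => /(congr1 (@nat_of_ord _)).
    by rewrite !inordK// ltnS le_truncn.
  have uu : `|u i - u i'| <= delta.
    apply: norm_rV_le => [|j]; first exact: ltW.
    have zE : z i j - z i' j = (u i ord0 j - u i' ord0 j) / delta.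
      by rewrite /z aE; ring.
    have /ltW := zz j; rewrite zE normrM normfV (gtr0_norm delta0).
    by rewrite ler_pdivrMr// mul1r !mxE.
  apply: le_trans (enorm_le_norm _) _.
  have [ui <-] := uP i; have [ui' <-] := uP i'.
  have [_ _ lip] := phiP (a i); rewrite -aE in ui' *.
  apply: (@le_trans _ _ (d.+1%:R * (L * delta))).
    apply: ler_pM => //; first by rewrite ler_nat.
    by apply: le_trans (lip _ _ ui ui') _; rewrite ler_pM2l.
  by rewrite mulrA mulrC /delta divfK// gt_eqF.
have := leq_card _ cell_inj.
rewrite card_ord card_prod card_ffun !card_ord -(ler_nat R) => /le_trans; apply.
rewrite natrM natrX -mulrA ler_wpM2l// -exprMn lerXn2r ?nnegrE//.
  by rewrite ltW// divr_gt0// addr_gt0// mulr_gt0.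
have mE : m%:R <= r * D / eps.
  apply: le_trans (_ : 2 * r / delta <= _); first by rewrite truncn_le.
  by rewrite /delta le_eqVlt; apply/orP; left; apply/eqP; field; rewrite ?gt_eqF.
rewrite -/D -[m.+1%:R]natr1 mulrDl mul1r lerD// -[leLHS]invr1 lef_pV2 ?posrE//.
Qed.

Lemma packing_numberE (R : realType) (d : nat) (M : set 'rV[R]_d) (eps : R) :
  packing_number M eps = sup [set N%:R | N in has_packing M eps].
Proof. by []. Qed.

(** The bound on the set comes with the bound on its supremum: it is what makes
    [packing_number] an upper bound of the packings found later. *)
Lemma packing_number_ub (R : realType) (d p k : nat) (M : set 'rV[R]_d)
    (V : 'I_k -> set 'rV[R]_d) (r L : R) :
  0 < r -> 0 < L -> (forall y, M y -> exists i, V i y) ->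
  (forall i, lipschitz_patch p M (V i) r L) ->
  exists2 C, 0 < C & forall eps, 0 < eps <= 1 ->
    has_ubound [set (N%:R : R) | N in has_packing M eps] /\
    packing_number M eps <= C * eps^-1 ^+ p.
Proof.
move=> r0 L0 Mcov patch.
pose C := k%:R * (r * (d.+1%:R * L) + 1) ^+ p.
have D0 : 0 <= r * (d.+1%:R * L) + 1 by rewrite ltW// addr_gt0// !mulr_gt0.
exists (C + 1); first by rewrite ltr_wpDl// mulr_ge0// exprn_ge0.
move=> eps eps01; have /andP[e0 _] := eps01.
have Cub : ubound [set (N%:R : R) | N in has_packing M eps] ((C + 1) * eps^-1 ^+ p).
  move=> _ [N sepN <-]; apply: le_trans (has_packing_le r0 L0 Mcov patch eps01 sepN) _.
  by rewrite ler_wpM2r ?lerDl// exprn_ge0// invr_ge0 ltW.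
split; first by exists ((C + 1) * eps^-1 ^+ p).
rewrite packing_numberE; apply: ge_sup => //.
exists 0, 0%N => //; exists (fun _ => 0); split; by case.
Qed.

(** The grid of mesh 3 eps / c inside the ball is mapped to a family separated
    by at least 3 eps > 2 eps; it has about (r c / 3 eps)^p points, at least
    half that many along each axis once eps is small. *)
Lemma packing_number_lb (R : realType) (d p : nat) (M : set 'rV[R]_d)
    (phi : 'rV[R]_p -> 'rV[R]_d) (u0 : 'rV[R]_p) (r c : R) :
  0 < r -> 0 < c ->
  (forall u, ball u0 r u -> M (phi u)) ->
  (forall u v, ball u0 r u -> ball u0 r v -> c * `|u - v| <= `|phi u - phi v|) ->
  (forall eps, 0 < eps <= 1 -> has_ubound [set (N%:R : R) | N in has_packing M eps]) ->
  exists C, 0 < C /\ exists2 e0, 0 < e0 & forall eps, 0 < eps <= e0 ->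
    C * eps^-1 ^+ p <= packing_number M eps.
Proof.
move=> r0 c0 Mphi phic Mub.
exists ((r * c / 6) ^+ p); split; first by rewrite exprn_gt0// divr_gt0// mulr_gt0.
exists (Num.min 1 (r * c / 6)); first by rewrite lt_min ltr01 divr_gt0// mulr_gt0.
move=> eps /andP[e0]; rewrite le_min => /andP[e1 er].
(* Any factor greater than 2 would do in place of 3. *)
pose delta := 3 * eps / c.
have delta0 : 0 < delta by rewrite divr_gt0// mulr_gt0.
have cdelta : c * delta = 3 * eps by rewrite /delta mulrC divfK// gt_eqF.
pose m := Num.truncn (r / delta).
have /andP[mr rm] : m%:R <= r / delta < m.+1%:R.
  by apply: truncn_itv; rewrite divr_ge0// ltW.
have rE : r / delta = r * c / 6 / eps * 2.
  by rewrite /delta; field; rewrite !gt_eqF.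
have r1 : 1 <= r * c / 6 / eps by rewrite ler_pdivlMr// mul1r.
have m0 : (0 < m)%N.
  rewrite lt0n; apply/negP => /eqP m0; move: rm; rewrite m0 rE; lra.
pose g (a : {ffun 'I_p -> 'I_m}) : 'rV[R]_p := u0 + delta *: \row_j (a j)%:R.
have gr a : ball u0 r (g a).
  rewrite mx_norm_ball /ball_ /= /g opprD addrA subrr sub0r normrN normrZ gtr0_norm//.
  rewrite mulrC -ltr_pdivlMr//; apply: lt_le_trans mr.
  apply: (@le_lt_trans _ _ m.-1%:R).
    apply: norm_rV_le => // j; rewrite mxE ger0_norm// ler_nat.
    by rewrite -ltnS prednK.
  by rewrite ltr_nat prednK.
have gsep a b : a != b -> delta <= `|g a - g b|.
  move=> /eqP ab.
  have [j abj] : exists j, a j != b j.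
    apply/existsP; rewrite -negb_forall; apply/negP => /forallP ab'.
    by apply: ab; apply/ffunP => j; apply/eqP.
  apply: le_trans (ler_coord_norm (g a - g b) ord0 j).
  rewrite !mxE opprD addrACA subrr add0r -mulrBr normrM gtr0_norm//.
  rewrite ler_peMr ?(ltW delta0)//.
  wlog ltab : a b ab abj / (a j < b j)%N.
    move=> H; have [/H|/H|/val_inj/eqP] := ltngtP (a j) (b j).
    - by apply.
    - by rewrite distrC; apply; [exact/nesym|rewrite eq_sym].
    - by rewrite (negbTE abj).
  by rewrite distrC -natrB ?(ltnW ltab)// normr_nat ler1n subn_gt0.
rewrite packing_numberE.
apply: (@le_trans _ _ (#|{ffun 'I_p -> 'I_m}|%:R)).
  rewrite card_ffun !card_ord natrX -exprMn lerXn2r ?nnegrE//.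
    by rewrite ltW// !(mulr_gt0, invr_gt0).
  by rewrite -natr1 rE in rm; lra.
apply: ub_le_sup; first by apply: Mub; rewrite e0.
exists #|{ffun 'I_p -> 'I_m}| => //.
exists (fun i => phi (g (enum_val i))); split=> [i|i j ij]; first exact: Mphi.
apply: lt_le_trans (enorm_ge_norm _).
apply: lt_le_trans (phic _ _ (gr _) (gr _)).
apply: (@lt_le_trans _ _ (c * delta)).
  by rewrite cdelta ltr_pM2r// ltr_nat.
rewrite ler_pM2l//; apply: gsep; apply: contra ij => /eqP/enum_val_inj ->//.
Qed.

(** * Iterated integrals and boxes *)

(** The integral of a nonnegative function is a supremum over the simple
    functions below it, so it is monotone without any measurability.  This is
    what allows iterated integrals to be compared without studying the
    measurability of the partial integrals. *)
Lemma ge0_le_integralT (d : measure_display) (T : measurableType d)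
    (R : realType) (mu : {measure set T -> \bar R}) (f g : T -> \bar R) :
  (forall x, 0 <= f x)%E -> (forall x, f x <= g x)%E ->
  (\int[mu]_(x in [set: T]) f x <= \int[mu]_(x in [set: T]) g x)%E.
Proof.
move=> f0 fg; have g0 x : (0 <= g x)%E by exact: le_trans (f0 x) (fg x).
rewrite !ge0_integralTE//; apply: le_ereal_sup => _ [h hf <-].
by exists h => // x; exact: le_trans (hf x) (fg x).
Qed.

Lemma integral_rV_ge0 (R : realType) (n : nat) (f : 'rV[R]_n -> \bar R) :
  (forall u, 0 <= f u)%E -> (0 <= integral_rV f)%E.
Proof.
elim: n f => [|n IH] f f0 /=; first exact: f0.
by apply: integral_ge0 => t _; apply: IH.
Qed.

Lemma le_integral_rV (R : realType) (n : nat) (f g : 'rV[R]_n -> \bar R) :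
  (forall u, 0 <= f u)%E -> (forall u, f u <= g u)%E ->
  (integral_rV f <= integral_rV g)%E.
Proof.
elim: n f g => [|n IH] f g f0 fg /=; first exact: fg.
apply: ge0_le_integralT => t; first by apply: integral_rV_ge0.
by apply: IH.
Qed.

(** The closed balls of the max norm, in the coordinates along which the
    iterated integral is taken. *)
Definition box (R : realType) (n : nat) (a : 'rV[R]_n) (r : R) :=
  [set u : 'rV[R]_n | forall j, `|a ord0 j - u ord0 j| <= r].

Lemma integral_rV_box (R : realType) (n : nat) (a : 'rV[R]_n) (r c : R) :
  0 <= r -> 0 <= c ->
  integral_rV (fun u => (c * \1_(box a r) u)%:E) = (c * (2 * r) ^+ n)%:E.
Proof.
move=> r0; elim: n a c => [|n IH] a c c0.
  rewrite /= expr0 indicE mem_set//; by case.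
rewrite [LHS]/=.
pose b : R := (a : 'rV_(1 + n)) ord0 (lshift n (ord0 : 'I_1)).
pose a' : 'rV_n := rsubmx (a : 'rV_(1 + n)).
pose I : set R := `[b - r, b + r]%classic.
transitivity (\int[lebesgue_measure]_(t in [set: R])
    (c * (2 * r) ^+ n * \1_I t)%:E)%E.
  apply: eq_integral => t _; rewrite mulrAC -(IH a') ?mulr_ge0//.
  congr integral_rV; apply/funext => v; congr (_%:E); rewrite -mulrA; congr (_ * _).
  rewrite !indicE -natrM mulnb; congr (_%:R); congr nat_of_bool.
  have vl (k : 'I_1) : (row_mx t%:M v : 'rV_(1 + n)) ord0 (lshift n k) = t.
    by rewrite row_mxEl !mxE (ord1 k) eqxx mulr1n.
  have vr (k : 'I_n) : (row_mx t%:M v : 'rV_(1 + n)) ord0 (rshift 1 k) = v ord0 k.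
    by rewrite row_mxEr.
  apply/idP/andP => [/set_mem H|[/set_mem It /set_mem H]].
    split; apply/mem_set.
      have := H (lshift n (ord0 : 'I_1)); rewrite vl -/b /I /=.
      by rewrite in_itv/= distrC ler_distl.
    by move=> j; have := H (rshift 1 (j : 'I_n)); rewrite vr /a' !mxE.
  apply/mem_set => j; rewrite -(splitK (j : 'I_(1 + n))); case: (fintype.split (j : 'I_(1 + n))) => k /=.
    rewrite vl (ord1 k).
    by move: It; rewrite /I /= in_itv/= distrC ler_distl.
  by have := H k; rewrite vr /a' !mxE.
under eq_integral do rewrite EFinM.
rewrite ge0_integralZl//=; last 2 first.
- by apply/measurable_EFinP; apply: measurable_indic; exact: measurable_itv.
- by rewrite lee_fin mulr_ge0// exprn_ge0// mulr_ge0.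
rewrite integral_indic; [|exact: measurableT|exact: measurable_itv].
rewrite setIT /= /I lebesgue_measure_itv/= lte_fin.
case: ltP => [_|]; last first.
  move=> h; have -> : r = 0 by lra.
  by rewrite mule0 mulr0 exprS mul0r mulr0.
by rewrite -EFinD -EFinM exprS; congr (_%:E); ring.
Qed.

(** * Convergence of the Gamma integral *)

(** The integrand may be unbounded at 0, so the fundamental theorem of calculus
    is applied on the intervals [1/(n+2), 1], which exhaust ]0, 1]; each of
    these integrals is at most 1/s. *)
Lemma integral_powR_01_le (R : realType) (s : R) : 0 < s ->
  (\int[lebesgue_measure]_(t in `]0%R, 1%R]) (t `^ (s - 1))%:E <= (s^-1)%:E)%E.
Proof.
move=> s0; pose F n : set R := `[n.+2%:R^-1, 1]%classic.
have FU : \bigcup_n F n = `]0, 1]%classic.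
  apply/seteqP; split => t; rewrite /F /=.
    by move=> [n _]; rewrite /= !in_itv/= => /andP[nt ->]; rewrite andbT (lt_le_trans _ nt).
  rewrite in_itv/= => /andP[t0 t1].
  exists (Num.truncn t^-1) => //=; rewrite in_itv/= t1 andbT.
  rewrite -[leRHS]invrK lef_pV2 ?posrE ?invr_gt0//.
  have /andP[_ /ltW/le_trans] : (Num.truncn t^-1)%:R <= t^-1 < (Num.truncn t^-1).+1%:R.
    by apply: truncn_itv; rewrite invr_ge0 ltW.
  by apply; rewrite ler_nat.
rewrite -FU.
have powm (A : set R) : measurable A ->
    measurable_fun A (fun t : R => (t `^ (s - 1))%:E).
  by move=> mA; apply/measurable_EFinP; apply: measurable_funTS; exact: measurable_powR.
have Fnd : nondecreasing_seq F.
  apply/nondecreasing_seqP => n; rewrite subsetEset => t; rewrite /F /= !in_itv/=.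
  move=> /andP[nt ->]; rewrite andbT (le_trans _ nt)// lef_pV2 ?posrE// ler_nat//.
have mF n : measurable (F n) by exact: measurable_itv.
have f0 n t : F n t -> (0 <= (t `^ (s - 1))%:E)%E by rewrite lee_fin powR_ge0.
have Fcvg : (\int[lebesgue_measure]_(t in F n) (t `^ (s - 1))%:E @[n --> \oo] -->
    \int[lebesgue_measure]_(t in \bigcup_n F n) (t `^ (s - 1))%:E)%E.
  apply: ge0_nondecreasing_set_cvg_integral => //.
  by move=> n; apply: powm; exact: mF.
rewrite -(cvg_lim _ Fcvg)//; apply: lime_le; first by apply/cvg_ex; eexists; exact: Fcvg.
near=> n.
have n1 : n.+2%:R^-1 < 1 :> R by rewrite invf_lt1// ltr1n.
have n0 : 0 < n.+2%:R^-1 :> R by [].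
have pos t : n.+2%:R^-1 <= t -> 0 < t :> R by exact: lt_le_trans.
have dF : derivable_oo_LRcontinuous (fun t : R => s^-1 * t `^ s) n.+2%:R^-1 1.
  have cF t : 0 < t :> R -> {for t, continuous (fun t : R => s^-1 * t `^ s)}.
    move=> t0; apply: cvgM; first exact: cvg_cst.
    have /derivable1_diffP/differentiable_continuous : derivable (@powR R ^~ s) t 1.
      by apply: derivable_powR; rewrite in_itv/= t0.
    exact.
  split.
  - move=> t; rewrite in_itv/= => /andP[/ltW/pos t0 _].
    by apply: derivableM => //; apply: derivable_powR; rewrite in_itv/= t0.
  - by apply: cvg_at_right_filter; apply: cF.
  - by apply: cvg_at_left_filter; apply: cF.
rewrite /F (continuous_FTC2 n1 _ dF).
- rewrite -EFinB lee_fin powR1 mulr1 lerBlDr lerDl mulr_ge0// ?invr_ge0 ?powR_ge0//.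
  exact: ltW.
- apply: derivable_within_continuous => t; rewrite in_itv/= => /andP[/pos t0 _].
  by apply: derivable_powR; rewrite in_itv/= t0.
- move=> t; rewrite in_itv/= => /andP[/ltW/pos t0 _].
  rewrite derive1E deriveM//; last by apply: derivable_powR; rewrite in_itv/= t0.
  rewrite derive_cst scaler0 addr0 -derive1E powR_derive1 ?in_itv/= ?t0//.
  by rewrite /GRing.scale /= mulrA mulVf ?mul1r// gt_eqF.
Unshelve. all: by end_near. Qed.

(** From x <= e^x at x = t / (2 s), raised to the power s. *)
Lemma powR_le_expR (R : realType) (s t : R) : 0 < s -> 1 <= t ->
  t `^ (s - 1) <= (2 * s) `^ s * expR (t / 2).
Proof.
move=> s0 t1; have t0 : 0 < t by rewrite (lt_le_trans _ t1).
apply: (@le_trans _ _ (t `^ s)); first by rewrite ler_powR// lerBlDr lerDl.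
have ts : t <= 2 * s * expR (t / (2 * s)).
  rewrite mulrC -ler_pdivrMr ?mulr_gt0//.
  by apply: le_trans (expR_ge1Dx _); rewrite lerDr.
apply: (@le_trans _ _ ((2 * s * expR (t / (2 * s))) `^ s)).
  by rewrite ge0_ler_powR ?nnegrE ?mulr_ge0 ?expR_ge0 ?(ltW s0) ?(ltW t0).
rewrite powRM ?mulr_ge0 ?expR_ge0 ?(ltW s0)// ler_wpM2l ?powR_ge0//.
rewrite -expRM ler_expR le_eqVlt; apply/orP; left; apply/eqP; field.
by rewrite gt_eqF.
Qed.

(** The real number [Gamma] comes from an extended one by sending infinite
    values to 0, so a divergent integral would give 0: finiteness has to be
    proved together with positivity.  The integrand is below t^(s-1) on ]0, 1]
    and below a multiple of the exponential density of rate 1/2 beyond 1. *)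
Lemma Gamma_gt0 (R : realType) (s : R) : 0 < s -> 0 < Gamma s.
Proof.
move=> s0; rewrite /Gamma /Rintegral.
set I := (\int[_]_(_ in _) _)%E.
pose f (t : R) : R := t `^ (s - 1) * expR (- t).
have f0 t : 0 <= f t by rewrite mulr_ge0 ?powR_ge0 ?expR_ge0.
suff /andP[I0 Ioo] : (0 < I < +oo)%E by rewrite fine_gt0// I0.
have IE : I = (\int[lebesgue_measure]_(t in [set: R])
    ((fun t : R => (f t)%:E) \_ `]0%R, +oo[%classic) t)%E.
  by rewrite /I integral_mkcond.
apply/andP; split.
  (* A lower bound of the integrand on [1, 2], whatever the sign of s - 1. *)
  pose c : R := Num.min 1 (2 `^ (s - 1)) * expR (-2).
  have c0 : 0 < c by rewrite mulr_gt0 ?expR_gt0// lt_min ltr01 powR_gt0.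
  apply: (@lt_le_trans _ _ (\int[lebesgue_measure]_(t in [set: R])
      (c * \1_`[1, 2]%classic t)%:E)%E).
    under eq_integral do rewrite EFinM.
    rewrite ge0_integralZl//=; last 2 first.
    - by apply/measurable_EFinP; apply: measurable_indic; exact: measurable_itv.
    - by rewrite lee_fin ltW.
    rewrite integral_indic; [|exact: measurableT|exact: measurable_itv].
    rewrite setIT /= lebesgue_measure_itv/= lte_fin ltr1n/=.
    by rewrite -EFinB -EFinM lte_fin mulr_gt0//; lra.
  rewrite IE; apply: ge0_le_integralT => t.
    by rewrite lee_fin mulr_ge0// ltW.
  rewrite indicE; case: (boolP (t \in _)) => [/set_mem|_]; last first.
    by rewrite mulr0 patchE; case: ifPn => // _; rewrite lee_fin.
  rewrite /= in_itv/= mulr1 => /andP[t1 t2].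
  rewrite patchE mem_set; last by rewrite /= in_itv/= andbT (lt_le_trans _ t1).
  rewrite lee_fin /c /f ler_pM ?expR_ge0 ?le_min ?ler01 ?powR_ge0//.
    have [s1|/ltW s1] := leP 1 s.
      apply: le_trans (_ : 1 `^ (s - 1) <= _); first by rewrite powR1 ge_min lexx.
      by rewrite ge0_ler_powR ?nnegrE ?subr_ge0// (le_trans _ t1).
    apply: le_trans (_ : 2 `^ (s - 1) <= _); first by rewrite ge_min lexx orbT.
    rewrite -(opprB 1 s) !powRN lef_pV2 ?posrE ?powR_gt0 ?(lt_le_trans _ t1)//.
    by rewrite ge0_ler_powR ?nnegrE ?subr_ge0// (le_trans _ t1).
  by rewrite ler_expR lerN2.
pose K : R := (2 * s) `^ s.
have K0 : 0 <= K by exact: powR_ge0.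
pose g1 : R -> \bar R := (fun t : R => (t `^ (s - 1))%:E) \_ `]0, 1]%classic.
pose g2 (t : R) : \bar R := ((2 * K) * exponential_pdf (2^-1) t)%:E.
have g10 t : (0 <= g1 t)%E.
  by rewrite /g1 patchE; case: ifP => // _; rewrite lee_fin powR_ge0.
have g20 t : (0 <= g2 t)%E.
  by rewrite /g2 lee_fin mulr_ge0 ?mulr_ge0// exponential_pdf_ge0.
have mg1 : measurable_fun [set: R] g1.
  apply/(measurable_restrictT _ _).1; first exact: measurable_itv.
  by apply/measurable_EFinP; apply: measurable_funTS; exact: measurable_powR.
have mpdf : measurable_fun [set: R] (exponential_pdf (2^-1) : R -> R).
  exact: measurable_exponential_pdf.
have mg2 : measurable_fun [set: R] g2.
  by apply/measurable_EFinP; exact: measurable_funM.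
have g1oo : (\int[lebesgue_measure]_(t in [set: R]) g1 t < +oo)%E.
  rewrite -integral_mkcond; apply: le_lt_trans (integral_powR_01_le s0) _.
  exact: ltry.
have g2oo : (\int[lebesgue_measure]_(t in [set: R]) g2 t < +oo)%E.
  rewrite /g2; under eq_integral do rewrite EFinM.
  rewrite ge0_integralZl//=; last 3 first.
  - exact/measurable_EFinP.
  - by move=> t _; rewrite lee_fin exponential_pdf_ge0.
  - by rewrite lee_fin mulr_ge0.
  by rewrite integral_exponential_pdf ?invr_gt0// mule1 ltry.
apply: (@le_lt_trans _ _ (\int[lebesgue_measure]_(t in [set: R]) (g1 t + g2 t))%E).
  rewrite IE; apply: ge0_le_integralT => t.
    by rewrite patchE; case: ifP => // _; rewrite lee_fin.
  rewrite patchE; case: ifPn => [|_]; last by rewrite adde_ge0.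
  move=> /set_mem; rewrite /= in_itv/= andbT => t0.
  have [t1|t1] := leP t 1.
    rewrite -[leLHS]adde0 leeD// /g1 patchE mem_set; last by rewrite /= in_itv/= t0.
    by rewrite lee_fin /f ler_piMr ?powR_ge0// expR_le1 oppr_le0 ltW.
  rewrite -[leLHS]add0e leeD// /g2 exponential_pdfE ?(ltW t0)//.
  rewrite lee_fin /f; apply: (@le_trans _ _ (K * expR (t / 2) * expR (- t))).
    by rewrite ler_wpM2r ?expR_ge0// powR_le_expR// ltW.
  have -> : 2 * K * (2^-1 * expR (- 2^-1 * t)) = K * expR (- 2^-1 * t).
    by field.
  rewrite -mulrA -expRD (_ : t / 2 + - t = - 2^-1 * t)//; by field.
by rewrite ge0_integralD//= lte_add_pinfty.
Qed.

(** * The volume density *)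

Lemma sqr_rV_gt0 (R : realType) (n : nat) (v : 'rV[R]_n) :
  v != 0 -> 0 < (v *m v^T) ord0 ord0.
Proof.
move=> v0; rewrite mxE; under eq_bigr do rewrite mxE -expr2.
rewrite lt0r sumr_ge0 ?andbT => [|i _]; last exact: sqr_ge0.
rewrite psumr_eq0 => [|i _]; last exact: sqr_ge0.
apply: contra v0 => /allP v0; apply/eqP/rowP => j; rewrite mxE.
by have := v0 j (mem_index_enum _); rewrite sqrf_eq0 => /eqP.
Qed.

Lemma cvg_det (R : realType) (T : Type) (F : set_system T) {FF : Filter F}
    (n : nat) (A : T -> 'M[R]_n) (B : 'M[R]_n) :
  (forall i j, A w i j @[w --> F] --> B i j) -> \det (A w) @[w --> F] --> \det B.
Proof.
move=> AB; rewrite /determinant; apply: cvg_big => [|s _]; first exact: add_continuous.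
apply: cvgM; first exact: cvg_cst.
by apply: cvg_big => [|i _]; [exact: mul_continuous|exact: AB].
Qed.

(** G = J J^T is positive definite, hence so is t G + (1 - t) I for t in [0, 1].
    The determinant of the latter does not vanish on [0, 1] and is 1 at t = 0,
    so it stays positive by the intermediate value theorem. *)
Lemma det_gram_gt0 (R : realType) (m n : nat) (J : 'M[R]_(m, n)) :
  row_free J -> 0 < \det (J *m J^T).
Proof.
move=> Jfree.
pose A (t : R) : 'M[R]_m := t *: (J *m J^T) + (1 - t) *: 1%:M.
have detA t : 0 <= t <= 1 -> \det (A t) != 0.
  move=> /andP[t0 t1]; apply/negP => /det0P[v v0 vA].
  have vJ0 : v *m J != 0.
    apply: contra v0 => /eqP vJ; apply/eqP/(row_free_inj Jfree).
    by rewrite vJ mul0mx.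
  have : (v *m A t *m v^T) ord0 ord0 = 0 by rewrite vA mul0mx mxE.
  rewrite /A mulmxDr mulmxDl -!scalemxAr -!scalemxAl mulmx1.
  rewrite (_ : v *m (J *m J^T) *m v^T = (v *m J) *m (v *m J)^T); last first.
    by rewrite trmx_mul !mulmxA.
  rewrite mxE [X in X + _]mxE [X in _ + X]mxE.
  have := sqr_rV_gt0 v0; have := sqr_rV_gt0 vJ0.
  move: (_ ord0 ord0) (_ ord0 ord0) => a b a0 b0 ab.
  have : 0 < t * b + (1 - t) * a by nra.
  by rewrite ab ltxx.
have Ac : continuous (fun t => \det (A t)).
  move=> t; apply: cvg_det => i j.
  under eq_fun do rewrite !mxE; rewrite /A !mxE.
  by apply: cvgD; (apply: cvgM; last exact: cvg_cst);
    [exact: cvg_id|apply: cvgB; [exact: cvg_cst|exact: cvg_id]].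
have A0 : \det (A 0) = 1.
  by rewrite /A scale0r add0r subr0 scale1r det1.
have A1 : A 1 = J *m J^T by rewrite /A scale1r subrr scale0r addr0.
rewrite ltNge; apply/negP => detJ.
have [||c] := @IVT _ (fun t => \det (A t)) 0 1 0 ler01.
- exact: continuous_subspaceT.
- by rewrite A0 A1 ge_min detJ orbT le_max ler01.
by rewrite in_itv/= => /detA/eqP.
Qed.

Definition volume_density (R : realType) (d p : nat)
    (phi : 'rV[R]_p -> 'rV[R]_d) (u : 'rV[R]_p) : R :=
  Num.sqrt (\det (gram phi u)).

Lemma gramE (R : realType) (d p : nat) (phi : 'rV[R]_p -> 'rV[R]_d) u i j :
  gram phi u i j = \sum_k 'J phi u i k * 'J phi u j k.
Proof. by rewrite mxE; apply: eq_bigr => k _; rewrite [_^T _ _]mxE. Qed.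

Lemma volume_density_continuous (R : realType) (d p : nat) (M : set 'rV[R]_d)
    (U : set 'rV[R]_p) (phi : 'rV[R]_p -> 'rV[R]_d) (u : 'rV[R]_p) :
  local_parametrization M U phi -> U u ->
  {for u, continuous (volume_density phi)}.
Proof.
move=> lp Uu.
have Jc i k : {for u, continuous (fun w => 'J phi w i k)}.
  exact: smooth_jacobian_continuous (lp_open lp) (lp_smooth lp) Uu.
have detc : \det (gram phi w) @[w --> u] --> \det (gram phi u).
  apply: (@cvg_det R _ (nbhs u) (nbhs_filter u)) => i j.
  have -> : (fun w => gram phi w i j) = fun w => \sum_k 'J phi w i k * 'J phi w j k.
    by apply/funext => w; exact: gramE.
  rewrite (gramE phi u i j).
  apply: cvg_big => [|k _]; first exact: add_continuous.
  by apply: cvgM; exact: Jc.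
exact: (cvg_comp _ _ detc (@sqrt_continuous R _)).
Qed.

Lemma volume_density_gt0 (R : realType) (d p : nat) (M : set 'rV[R]_d)
    (U : set 'rV[R]_p) (phi : 'rV[R]_p -> 'rV[R]_d) (u : 'rV[R]_p) :
  local_parametrization M U phi -> U u -> 0 < volume_density phi u.
Proof.
by move=> lp Uu; rewrite sqrtr_gt0; apply/det_gram_gt0/(lp_immersion lp).
Qed.

Lemma local_parametrizationS (R : realType) (d p : nat) (M : set 'rV[R]_d)
    (U W : set 'rV[R]_p) (phi : 'rV[R]_p -> 'rV[R]_d) :
  local_parametrization M U phi -> open W -> W `<=` U ->
  local_parametrization M W phi.
Proof.
move=> [oU sU iU jU mU] oW WU; split => //.
- by move=> vs u /WU; exact: sU.
- by move=> u /WU; exact: iU.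
- by move=> u v /set_mem/WU/mem_set uU /set_mem/WU/mem_set vU; exact: jU.
- by move=> W' oW' W'W; apply: mU => //; exact: subset_trans W'W WU.
Qed.

Lemma local_parametrization_mem (R : realType) (d p : nat) (M : set 'rV[R]_d)
    (U : set 'rV[R]_p) (phi : 'rV[R]_p -> 'rV[R]_d) u :
  local_parametrization M U phi -> U u -> M (phi u).
Proof.
move=> lp Uu; have [V _ UV] := lp_open_map lp (lp_open lp) (@subset_refl _ U).
have : (phi @` U) (phi u) by exists u.
by rewrite UV => -[].
Qed.

Lemma box_sub_ball (R : realType) (n : nat) (a : 'rV[R]_n) (r r' : R) :
  0 <= r -> r < r' -> box a r `<=` ball a r'.
Proof.
move=> r0 rr' u ur; rewrite mx_norm_ball /ball_ /=; apply: le_lt_trans rr'.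
by apply: norm_rV_le => // j; rewrite !mxE; exact: ur.
Qed.

Lemma ball_sub_box (R : realType) (n : nat) (a : 'rV[R]_n) (r : R) :
  ball a r `<=` box a r.
Proof.
move=> u; rewrite mx_norm_ball /ball_ /= => /ltW ur j.
by apply: le_trans ur; have := ler_coord_norm (a - u) ord0 j; rewrite !mxE.
Qed.

Lemma box_compact (R : realType) (n : nat) (a : 'rV[R]_n) (r : R) :
  compact (box a r).
Proof.
rewrite (_ : box a r =
    [set v | forall i, `[a ord0 i - r, a ord0 i + r]%classic (v ord0 i)]).
  apply: (@rV_compact R n (fun i => `[a ord0 i - r, a ord0 i + r]%classic)) => i.
  exact: segment_compact.
by apply/seteqP; split => v vr j; have := vr j; rewrite /= in_itv/= distrC ler_distl.
Qed.

(** * The Riemannian volume *)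

(** At a point x of M some rho_i is positive, and x lies in the i-th chart
    since rho_i is supported there.  The i-th integrand is continuous and
    positive at the parameter of x, so it exceeds a positive constant on a
    box. *)
Lemma riemannian_volume_witness_gt0 (R : realType) (d p : nat)
    (M : set 'rV[R]_d) (v : R) :
  M !=set0 -> is_riemannian_volume p M v -> 0 < v.
Proof.
move=> [x Mx] [k [U [phi [rho [lp rhoc rhoK rho1 vE]]]]].
pose f i u : R := \1_(U i) u * rho i (phi i u) * Num.sqrt (\det (gram (phi i) u)).
have f0 i u : 0 <= f i u.
  by rewrite /f !mulr_ge0 ?sqrtr_ge0//; have [_ ->] := rhoc i.
have [i rhoi] : exists i, 0 < rho i x.
  apply/not_existsP => rho0; have := rho1 x Mx.
  rewrite big1 => [/esym/eqP|i _]; first by rewrite oner_eq0.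
  by apply/eqP; rewrite eq_le leNgt; apply/andP; split; [apply/negP/rho0|have [_ ->] := rhoc i].
have [K [_ KU] rho0] := rhoK i.
have [u0 Uu0 phiu0] : (phi i @` U i) x.
  apply: KU; apply: contrapT => /(rho0 _ Mx) rhoi0.
  by rewrite rhoi0 ltxx in rhoi.
have phic : {for u0, continuous (phi i)}.
  exact: differentiable_continuous (lp_smooth (lp i) [::] Uu0).
have rhoic : {for phi i u0, continuous (rho i)} by have [+ _] := rhoc i; apply.
have fc : {for u0, continuous (fun u => rho i (phi i u) * volume_density (phi i) u)}.
  apply: continuousM; last exact: volume_density_continuous (lp i) Uu0.
  exact: continuous_comp.
pose c := rho i (phi i u0) * volume_density (phi i) u0.
have c0 : 0 < c by rewrite mulr_gt0 ?phiu0//; exact: volume_density_gt0 (lp i) Uu0.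
have : \forall u \near u0, U i u /\ c / 2 <= f i u.
  have Unear : \forall u \near u0, U i u.
    by apply: open_nbhs_nbhs; split => //; exact: lp_open (lp i).
  have cnear : \forall u \near u0, c / 2 <= rho i (phi i u) * volume_density (phi i) u.
    by apply: (cvgr_ge c fc); rewrite ltr_pdivrMr// ltr_pMr// ltr1n.
  apply: filterS2 Unear cnear => u Uu cu; split; first exact: Uu.
  by rewrite /f indicE (mem_set Uu) mul1r; exact: cu.
move=> /nbhs_ballP[e /= e0 fe].
pose r := e / 2.
have r0 : 0 < r by rewrite divr_gt0.
have re : r < e by rewrite ltr_pdivrMr// ltr_pMr// ltr1n.
have c20 : 0 < c / 2 by rewrite divr_gt0.
have Ii : ((c / 2 * (2 * r) ^+ p)%:E <= integral_rV (fun u => (f i u)%:E))%E.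
  rewrite -(integral_rV_box u0 (ltW r0) (ltW c20)).
  apply: le_integral_rV => u; first by rewrite lee_fin mulr_ge0// ltW.
  rewrite lee_fin indicE; case: (boolP (u \in _)) => [/set_mem ur|_].
    by rewrite mulr1; have [] := fe _ (box_sub_ball (ltW r0) re ur).
  by rewrite mulr0; exact: f0.
rewrite -lte_fin vE (bigD1 i)//=.
apply: (@lt_le_trans _ _ (c / 2 * (2 * r) ^+ p)%:E).
  by rewrite lte_fin mulr_gt0// exprn_gt0// mulr_gt0.
rewrite -[leLHS]adde0; apply: leeD => //.
apply: sume_ge0 => j _; apply: integral_rV_ge0 => u; rewrite lee_fin; exact: f0.
Unshelve. all: by end_near. Qed.

(** Around each point there is a chart whose domain is a ball on which the
    density is bounded, together with a compact part K of its image that still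
    contains a neighbourhood of x in M: bounded density makes the integrals
    finite, and K hosts the support of a function of the partition of unity. *)
Lemma volume_chart (R : realType) (d p : nat) (M : set 'rV[R]_d) (x : 'rV[R]_d) :
  smooth_submanifold p M -> M x ->
  exists2 s, 0 < s & exists (phi : 'rV[R]_p -> 'rV[R]_d) (u0 : 'rV[R]_p) (r C : R),
    [/\ 0 < r, local_parametrization M (ball u0 r) phi,
        forall u, ball u0 r u -> volume_density phi u <= C &
        exists2 K, compact K /\ K `<=` phi @` ball u0 r &
          forall y, M y -> ball x s y -> K y].
Proof.
move=> Ms Mx; have [U [phi [lp [u0 Uu0 phiu0]]]] := Ms x Mx.
pose C := volume_density phi u0 + 1.
have : \forall u \near u0, U u /\ volume_density phi u <= C.
  have Unear : \forall u \near u0, U u.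
    by apply: open_nbhs_nbhs; split => //; exact: lp_open lp.
  have Cnear : \forall u \near u0, volume_density phi u <= C.
    by apply: cvgr_le (volume_density_continuous lp Uu0) _ _; rewrite ltrDl.
  by near=> u; split; near: u.
move=> /nbhs_ballP[r /= r0 Ur].
have rU : ball u0 r `<=` U by move=> u /Ur[].
have lpr := local_parametrizationS lp (ball_open u0 r) rU.
have r20 : 0 < r / 2 by rewrite divr_gt0.
have r2r : r / 2 < r by rewrite ltr_pdivrMr// ltr_pMr// ltr1n.
have [V oV phiV] := lp_open_map lpr (ball_open u0 (r / 2)) (le_ball (ltW r2r)).
have Vx : V x.
  have : (phi @` ball u0 (r / 2)) x by exists u0 => //; exact: ballxx.
  by rewrite phiV => -[].
have /nbhs_ballP[s /= s0 sV] : nbhs x V by exact: open_nbhs_nbhs.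
exists s => //; exists phi, u0, r, C; split => //; first by move=> u /Ur[].
exists (phi @` box u0 (r / 2)).
  split; last first.
    by move=> _ [u ur <-]; exists u => //; apply: box_sub_ball ur; rewrite // ltW.
  apply: continuous_compact; last exact: box_compact.
  apply: continuous_in_subspaceT => u /set_mem ur.
  apply: differentiable_continuous.
  apply: (lp_smooth lpr [::]); apply: box_sub_ball ur => //; exact: ltW.
move=> y My /sV Vy.
have : (phi @` ball u0 (r / 2)) y by rewrite phiV.
by move=> [u /ball_sub_box ur <-]; exists u.
Unshelve. all: by end_near. Qed.

Definition tent (R : realType) (d : nat) (c : 'rV[R]_d) (s : R) (y : 'rV[R]_d) : R :=
  Num.max 0 (s - `|c - y|).

Lemma tent_continuous (R : realType) (d : nat) (c : 'rV[R]_d) (s : R) :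
  continuous (tent c s).
Proof.
move=> y; pose g (y : 'rV[R]_d) : R := s - `|c - y|.
have : {for y, continuous g}; last first.
  by apply: (@continuous_max R 'rV[R]_d (cst 0) g y); exact: cst_continuous.
have cB : {for y, continuous (fun y : 'rV[R]_d => c - y)}.
  by apply: (@continuousB R _ _ (cst c) id); [exact: cst_continuous|exact: cvg_id].
have nB : {for y, continuous (fun y : 'rV[R]_d => `|c - y|)}.
  exact: (continuous_comp cB (@norm_continuous _ _ _)).
by apply: (@continuousB R _ _ (cst s) _ y _ nB); exact: cst_continuous.
Qed.

Lemma tent_ge0 (R : realType) (d : nat) (c : 'rV[R]_d) (s : R) y : 0 <= tent c s y.
Proof. by rewrite /tent le_max lexx. Qed.

Lemma tent_gt0 (R : realType) (d : nat) (c : 'rV[R]_d) (s : R) y :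
  (0 < tent c s y) <-> ball c s y.
Proof.
by rewrite /tent lt_max ltxx subr_gt0 mx_norm_ball.
Qed.

(** Divide the tents by their sum S.  As rho has to be continuous on the whole
    space, while S vanishes far from M, the divisor is the maximum of S and of
    its minimum m > 0 on M, which is S itself on M. *)
Lemma ball_partition_of_unity (R : realType) (d k : nat) (M : set 'rV[R]_d)
    (c : 'I_k -> 'rV[R]_d) (s : 'I_k -> R) :
  M !=set0 -> compact M -> (forall y, M y -> exists i, ball (c i) (s i) y) ->
  exists rho : 'I_k -> 'rV[R]_d -> R,
  [/\ forall i, continuous (rho i), forall i y, 0 <= rho i y <= 1,
      forall i y, ~ ball (c i) (s i) y -> rho i y = 0 &
      forall y, M y -> \sum_(i < k) rho i y = 1].
Proof.
move=> M0 Mc Mcov.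
pose psi i := tent (c i) (s i); pose S y := \sum_(i < k) psi i y.
have psi0 i y : 0 <= psi i y by exact: tent_ge0.
have Sc : continuous S.
  by apply: continuous_big => [|i _]; [exact: add_continuous|exact: tent_continuous].
have [y0 /set_mem My0 y0min] := EVT_min_rV M0 Mc (continuous_subspaceT Sc).
have SM y : M y -> 0 < S y.
  move=> /Mcov[i /tent_gt0 yi]; rewrite /S (bigD1 i)//= ltr_pwDl//.
  by apply: sumr_ge0 => j _; exact: psi0.
pose m := S y0; have m0 : 0 < m by exact: SM.
pose D y := Num.max (S y) m.
have D0 y : 0 < D y by rewrite /D lt_max m0 orbT.
have Dc : continuous D.
  move=> y; have := Sc y; move/(@continuous_max R 'rV[R]_d S (cst m) y); apply.
  exact: cst_continuous.
exists (fun i y => psi i y / D y); split.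
- move=> i y; apply: continuousM; first exact: tent_continuous.
  by apply: continuousV; [rewrite gt_eqF|exact: Dc].
- move=> i y; rewrite divr_ge0 ?(ltW (D0 y))//= ler_pdivrMr// mul1r.
  rewrite /D le_max /S (bigD1 i)//= lerDl sumr_ge0// => j _; exact: psi0.
- move=> i y nyi; rewrite (_ : psi i y = 0) ?mul0r//; apply/eqP.
  by rewrite eq_le psi0 andbT leNgt; apply/negP => /tent_gt0.
- move=> y My; rewrite -mulr_suml -/(S y).
  have -> : D y = S y by rewrite /D max_l//; apply: y0min; exact/mem_set.
  by rewrite mulfV// gt_eqF// SM.
Qed.

Lemma riemannian_volume_exists (R : realType) (d p : nat) (M : set 'rV[R]_d) :
  M !=set0 -> compact M -> smooth_submanifold p M ->
  exists v : R, is_riemannian_volume p M v.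
Proof.
move=> M0 Mc Ms.
have [k [c [s [cP Mcov]]]] :=
  compact_finite_ball_cover Mc (fun x Mx => volume_chart Ms Mx).
have [rho [rhoc rho01 rhos rho1]] := ball_partition_of_unity M0 Mc Mcov.
have /choice[phi /choice[u0 /choice[r /choice[C chartP]]]] := fun i => let: And3 _ _ h := cP i in h.
pose f i u : R := \1_(ball (u0 i) (r i)) u * rho i (phi i u) * volume_density (phi i) u.
have f0 i u : 0 <= f i u.
  by rewrite /f !mulr_ge0 ?sqrtr_ge0//; have /andP[] := rho01 i (phi i u).
have fin i : integral_rV (fun u => (f i u)%:E) \is a fin_num.
  have [r0 lpi rC _] := chartP i.
  have C0 : 0 <= C i by apply: le_trans (rC _ (ballxx _ r0)); exact: sqrtr_ge0.
  rewrite ge0_fin_numE; last by apply: integral_rV_ge0 => u; rewrite lee_fin; exact: f0.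
  apply: (@le_lt_trans _ _ (C i * (2 * r i) ^+ p)%:E); last exact: ltry.
  rewrite -(integral_rV_box (u0 i) (ltW r0) C0).
  apply: le_integral_rV => u; first by rewrite lee_fin; exact: f0.
  rewrite lee_fin /f indicE.
  have [ur|nur] := pselect (ball (u0 i) (r i) u); last first.
    by rewrite (memNset nur) !mul0r mulr_ge0.
  rewrite (mem_set ur) mul1r indicE (mem_set (ball_sub_box ur)) mulr1.
  have /andP[rho0 rhole1] := rho01 i (phi i u).
  by rewrite -[leRHS]mul1r ler_pM ?sqrtr_ge0//; exact: rC.
exists (\sum_(i < k) fine (integral_rV (fun u => (f i u)%:E))).
exists k, (fun i => ball (u0 i) (r i)), phi, rho; split.
- by move=> i; have [] := chartP i.
- by move=> i; split; [exact: rhoc|move=> y; have /andP[] := rho01 i y].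
- move=> i; have [_ _ _ [K KP MK]] := chartP i; exists K => // y My nKy.
  by apply: rhos => yi; apply: nKy; exact: MK.
- exact: rho1.
- by rewrite -sumEFin; apply: eq_bigr => i _; rewrite fineK.
Qed.

Lemma riemannian_volume_gt0 (R : realType) (d p : nat) (M : set 'rV[R]_d) :
  M !=set0 -> compact M -> smooth_submanifold p M -> 0 < riemannian_volume p M.
Proof.
move=> M0 Mc Ms; apply: (@riemannian_volume_witness_gt0 _ _ p M _ M0).
exact: getPex (riemannian_volume_exists M0 Mc Ms).
Qed.

Lemma sphere_area_gt0 (R : realType) (p : nat) : (0 < p)%N -> 0 < sphere_area R p.
Proof.
move=> p0; rewrite divr_gt0 ?mulr_gt0 ?powR_gt0 ?pi_gt0//.
by apply: Gamma_gt0; rewrite divr_gt0// ltr0n.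
Qed.

(** * The order of the packing number of a submanifold *)

Lemma local_parametrization_nearC1 (R : realType) (d p : nat) (M : set 'rV[R]_d)
    (U : set 'rV[R]_p) (phi : 'rV[R]_p -> 'rV[R]_d) u0 :
  local_parametrization M U phi -> U u0 ->
  (\forall w \near u0, differentiable phi w) /\
  (forall i j, {for u0, continuous (fun w => 'J phi w i j)}).
Proof.
move=> lp Uu0; split.
  have Unear : \forall u \near u0, U u.
    by apply: open_nbhs_nbhs; split => //; exact: lp_open lp.
  by apply: filterS Unear => w Uw; exact: (lp_smooth lp [::] Uw).
by move=> i j; exact: smooth_jacobian_continuous (lp_open lp) (lp_smooth lp) Uu0.
Qed.

Lemma submanifold_lipschitz_patch (R : realType) (d p : nat) (M : set 'rV[R]_d)
    (x : 'rV[R]_d) :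
  smooth_submanifold p M -> M x ->
  exists2 s, 0 < s & exists2 L, 0 < L & exists2 r, 0 < r &
    lipschitz_patch p M (ball x s) r L.
Proof.
move=> Ms Mx; have [U [phi [lp [u0 Uu0 phiu0]]]] := Ms x Mx.
have [phid Jc] := local_parametrization_nearC1 lp Uu0.
pose L0 : R := `|'J phi u0| + 1.
have L00 : 0 <= L0 by rewrite addr_ge0.
have JL i j : `|'J phi u0 i j| < L0 by rewrite ltr_pwDr//; exact: ler_coord_norm.
have lip := lipschitz_near L00 phid Jc JL.
have Unear : \forall r \near 0^'+, ball u0 r `<=` U.
  by apply: open_subball => //; exact: lp_open lp.
have [r [r0 rlip rU]] : exists r : R, [/\ 0 < r,
    forall u v, ball u0 r u -> ball u0 r v -> `|phi u - phi v| <= p%:R * L0 * `|u - v| &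
    ball u0 r `<=` U].
  near (0 : R)^'+ => r; exists r; split; [by []|near: r; exact: lip|by near: r].
have [V oV phiV] := lp_open_map lp (ball_open u0 r) rU.
have Vx : V x.
  have : (phi @` ball u0 r) x by exists u0 => //; exact: ballxx.
  by rewrite phiV => -[].
have /nbhs_ballP[s /= s0 sV] : nbhs x V by exact: open_nbhs_nbhs.
exists s => //; exists (p%:R * L0 + 1); first by rewrite ltr_wpDl// mulr_ge0.
exists r => //; exists phi, u0, (ball u0 r); split => //.
- move=> y My /sV Vy; have : (phi @` ball u0 r) y by rewrite phiV.
  by move=> [u ur <-]; exists u.
- move=> u v ur vr; apply: le_trans (rlip u v ur vr) _.
  by rewrite ler_wpM2r// lerDl.
Unshelve. all: by end_near. Qed.

Lemma submanifold_packing_ub (R : realType) (d p : nat) (M : set 'rV[R]_d) :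
  compact M -> smooth_submanifold p M ->
  exists2 C, 0 < C & forall eps, 0 < eps <= 1 ->
    has_ubound [set (N%:R : R) | N in has_packing M eps] /\
    packing_number M eps <= C * eps^-1 ^+ p.
Proof.
move=> Mc Ms.
have [k [c [s [cP Mcov]]]] := compact_finite_ball_cover Mc
  (fun x Mx => submanifold_lipschitz_patch Ms Mx).
have /choice[L LP] : forall i, exists L, 0 < L /\ exists2 r, 0 < r &
    lipschitz_patch p M (ball (c i) (s i)) r L.
  by move=> i; have [_ _ [L L0 h]] := cP i; exists L.
have /choice[r rP] : forall i, exists r, 0 < r /\
    lipschitz_patch p M (ball (c i) (s i)) r (L i).
  by move=> i; have [_ [r r0 h]] := LP i; exists r.
have sum_ge (F : 'I_k -> R) i : (forall j, 0 < F j) -> F i <= \sum_j F j + 1.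
  move=> F0; rewrite (bigD1 i)//= -addrA lerDl addr_ge0// sumr_ge0// => j _.
  exact: ltW.
have sum_gt0 (F : 'I_k -> R) : (forall j, 0 < F j) -> 0 < \sum_j F j + 1.
  by move=> F0; rewrite ltr_wpDl// sumr_ge0// => j _; exact: ltW.
have L0 i := (LP i).1; have r0 i := (rP i).1.
apply: (@packing_number_ub _ _ _ _ _ (fun i => ball (c i) (s i))
  (\sum_j r j + 1) (\sum_j L j + 1)) => //; [exact: sum_gt0|exact: sum_gt0|move=> i].
by apply: lipschitz_patchW (rP i).2; exact: sum_ge.
Qed.

Lemma submanifold_packing_lb (R : realType) (d p : nat) (M : set 'rV[R]_d) :
  M !=set0 -> compact M -> smooth_submanifold p M ->
  exists C, 0 < C /\ exists2 e0, 0 < e0 & forall eps, 0 < eps <= e0 ->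
    C * eps^-1 ^+ p <= packing_number M eps.
Proof.
move=> [x Mx] Mc Ms; have [U [phi [lp [u0 Uu0 phiu0]]]] := Ms x Mx.
have [phid Jc] := local_parametrization_nearC1 lp Uu0.
have [c c0 expanding] := immersion_expanding phid Jc (lp_immersion lp Uu0).
have Unear : \forall r \near 0^'+, ball u0 r `<=` U.
  by apply: open_subball => //; exact: lp_open lp.
have [r [r0 rexp rU]] : exists r : R, [/\ 0 < r,
    forall u v, ball u0 r u -> ball u0 r v -> c * `|u - v| <= `|phi u - phi v| &
    ball u0 r `<=` U].
  near (0 : R)^'+ => r; exists r; split; [by []|near: r; exact: expanding|by near: r].
have [C' _ CP] := submanifold_packing_ub Mc Ms.
apply: (@packing_number_lb _ _ _ _ phi u0 r c) => //.
- by move=> u /rU Uu; exact: local_parametrization_mem lp Uu.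
- by move=> eps /CP[].
Unshelve. all: by end_near. Qed.

(** * Asymptotics *)

(** Both logarithms are within bounded distance of n ln(1/eps), so the ratio
    lies between 1 - q and 1 + q where q is a constant over the diverging
    denominator. *)
Lemma ln_ratio_cvg (R : realType) (n : nat) (P : R -> R) (c1 c2 a e0 : R) :
  (0 < n)%N -> 0 < c1 -> 0 < c2 -> 0 < a -> 0 < e0 ->
  (forall eps, 0 < eps <= e0 -> c1 * eps^-1 ^+ n <= P eps <= c2 * eps^-1 ^+ n) ->
  ln (P eps) / (ln (eps^-1 ^+ n * a)) @[eps --> 0^'+] --> (1 : R).
Proof.
move=> n0 c10 c20 a0 e00 Pbnd.
have lnoo : ln (eps^-1 ^+ n * a) @[eps --> 0^'+] --> +oo.
  apply/cvgryPge => A; near=> eps.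
  have eps0 : 0 < eps by [].
  rewrite lnM ?posrE ?exprn_gt0 ?invr_gt0// lnXn ?invr_gt0// lnV ?posrE//.
  have : ln eps <= (ln a - A) / n%:R by near: eps; exact: (cvgrNy_le (@lnNy R)).
  by rewrite ler_pdivlMr ?ltr0n// -mulr_natr; lra.
pose K : R := `|ln c1 - ln a| + `|ln c2 - ln a|.
pose q (eps : R) := K / ln (eps^-1 ^+ n * a).
have q0 : q eps @[eps --> 0^'+] --> 0.
  rewrite -[X in _ --> X](mulr0 K); apply: cvgM; first exact: cvg_cst.
  by apply/gtr0_cvgV0; [exact: (cvgry_gt lnoo 0)|exact: lnoo].
apply: (@squeeze_cvgr _ _ _ _ (fun eps => 1 - q eps) (fun eps => 1 + q eps)).
- near=> eps.
  have e0' : 0 < eps by [].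
  have D0 : 0 < ln (eps^-1 ^+ n * a).
    by near: eps; exact: (cvgry_gt lnoo).
  have en0 : 0 < eps^-1 ^+ n by rewrite exprn_gt0// invr_gt0.
  have /andP[Plb Pub] : c1 * eps^-1 ^+ n <= P eps <= c2 * eps^-1 ^+ n.
    by apply: Pbnd; rewrite e0'/=; near: eps; exact: nbhs_right_le.
  have P0 : 0 < P eps by apply: lt_le_trans Plb; rewrite mulr_gt0.
  have lnlb : ln c1 + ln (eps^-1 ^+ n) <= ln (P eps).
    by rewrite -lnM ?posrE// ler_ln ?posrE// mulr_gt0.
  have lnub : ln (P eps) <= ln c2 + ln (eps^-1 ^+ n).
    by rewrite -lnM ?posrE// ler_ln ?posrE// mulr_gt0.
  have qD : q eps * ln (eps^-1 ^+ n * a) = K by rewrite /q divfK// gt_eqF.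
  rewrite ler_pdivlMr// ler_pdivrMr// mulrBl [(1 + _) * _]mulrDl !mul1r qD.
  have := ler_norm (- (ln c1 - ln a)); have := ler_norm (ln c2 - ln a).
  have := normr_ge0 (ln c1 - ln a); have := normr_ge0 (ln c2 - ln a).
  rewrite normrN lnM ?posrE// /K; lra.
- rewrite -[X in _ --> X]subr0; apply: cvgB => //; exact: cvg_cst.
- rewrite -[X in _ --> X]addr0; apply: cvgD => //; exact: cvg_cst.
Unshelve. all: by end_near. Qed.

Unset Implicit Arguments.

Theorem proposition4p1 (R : realType) (d p : nat) (M : set 'rV[R]_d)
  (hp : (0 < p)%N) (hM0 : M !=set0) (hMc : compact M)
  (hMs : smooth_submanifold p M)
  (hB : exists C : R, forall x, M x ->
     `|2 * sff_sqnorm p M x - enorm (mean_curvature_vector p M x) ^+ 2| <= C) :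
  exists2 r : R -> R, r eps @[eps --> 0^'+] --> (0 : R) &
    ln (packing_number M eps) /
      (ln ((1 / eps) ^+ p * (p%:R * riemannian_volume p M / sphere_area R p))
        + r eps) @[eps --> 0^'+] --> (1 : R).
Proof.
exists (fun=> 0); first exact: cvg_cst.
under eq_fun do rewrite addr0 div1r.
have [c1 [c10 [e1 e10 lb]]] := submanifold_packing_lb hM0 hMc hMs.
have [c2 c20 ub] := submanifold_packing_ub hMc hMs.
apply: (@ln_ratio_cvg _ _ _ c1 c2 _ (Num.min 1 e1)) => //.
- apply: divr_gt0; last exact: sphere_area_gt0.
  by apply: mulr_gt0; [rewrite ltr0n|exact: riemannian_volume_gt0].
- by rewrite lt_min ltr01.
- move=> eps /andP[eps0]; rewrite le_min => /andP[le1 lee1].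
  by rewrite lb ?eps0//=; apply: (ub eps _).2; rewrite eps0.
Qed.
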